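(* For $a,c\in\mathbb{C}$ let $F_{a,c}:\mathbb{C}^2\to\mathbb{C}^2$ be the map $F_{a,c}(x,y)=(x^2+c-ay,\;x)$. For each $a\ne0$ and each $c$ such that $$|c|>\left(\frac54+\frac{\sqrt5}{2}\right)(1+|a|)^2,$$ there exists $R>0$ such that $F_{a,c}:\overline{D_R}^2\to\mathbb{C}^2$ is a complex horseshoe (of degree $2$), where $D_R\subset\mathbb{C}$ is the open disc of radius $R$ centered at $0$.
   Context: $D\subset\mathbb{C}$ is the open unit disc and $\pi_1,\pi_2:\mathbb{C}^2\to\mathbb{C}$ are the coordinate projections. Embedded bidisc: $\varphi:\overline{D}^2\to\mathbb{C}^2$ is an embedding, analytic on $D^2$, with $B=\varphi(D^2)$, $\overline{B}=\varphi(\overline{D}^2)$. Put $\partial B_H=\varphi(\overline{D}\times\partial\overline{D})$, $\partial B_V=\varphi(\partial\overline{D}\times\overline{D})$, and for $x,y\in D$, $H_y=\varphi(D\times\{y\})$, $V_x=\varphi(\{x\}\times D)$. For $B=D_R^2$ take $\varphi(x,y)=(Rx,Ry)$. Quasi-Hénon-like mapping of degree $d\ge2$: a map $F:\overline{B}\to\mathbb{C}^2$ for which there is $G:\overline{B}\to\mathbb{C}^2$ such that: (i) $F$ and $G$ are injective and continuous on $\overline{B}$ and analytic on $B$; (ii) $F\circ G=\mathrm{Id}$ and $G\circ F=\mathrm{Id}$ wherever these make sense ($G$ is then denoted $F^{-1}$); (iii) either (a) $F(\overline{B})\cap\partial B_H=\emptyset$ and $\overline{B}\cap F(\partial B_V)=\emptyset$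 ($F$ is called horizontal), or (b) $\overline{B}\cap F(\partial B_H)=\emptyset$ and $F(\overline{B})\cap\partial B_V=\emptyset$ ($F$ is called vertical); (iv) in case (a), the proper map $\pi_1\circ\varphi^{-1}:F(H_y)\cap B\to D$ has degree $d$ (it does not depend on $y\in D$); in case (b), the proper map $\pi_2\circ\varphi^{-1}:F(V_x)\cap B\to D$ has degree $d$ (it does not depend on $x\in D$). Iterates: $F^{\circ m}(B)$ (resp. $F^{\circ -m}(B)$) is the set of all points $F^{\circ m}(z)$ (resp. $(F^{-1})^{\circ m}(z)$), $z\in B$, for which the iterate is defined (as iterates of the maps $F,F^{-1}$ with domain $\overline{B}$). Complex horseshoe of degree $d$: a quasi-Hénon-like mapping $F:\overline{B}\to\mathbb{C}^2$ of degree $d$ such that for all integers $n>0$, if $F$ is horizontal, the projections $\pi_1\circ\varphi^{-1}:\bigcap_{0\le m\le n}F^{\circ m}(B)\to D$ and $\pi_2\circ\varphi^{-1}:\bigcap_{0\le m\le n}F^{\circ -m}(B)\to D$ are trivial fibrations with fibers disjoint unions of $d^n$ discs; if $F$ is vertical, the same holds for $\pi_2\circ\varphi^{-1}:\bigcap_{0\le m\le n}F^{\circ m}(B)\to D$ and $\pi_1\circ\varphi^{-1}:\bigcap_{0\le m\le n}F^{\circ -m}(B)\to D$. *)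

(* Defs.v *)
From HB Require Import structures.
From mathcomp Require Import all_boot all_order all_algebra.
From mathcomp Require Import complex.
From mathcomp Require Import all_classical all_reals all_analysis.

Set Implicit Arguments.
Unset Strict Implicit.
Unset Printing Implicit Defensive.

Import Order.TTheory GRing.Theory Num.Theory.
Import numFieldNormedType.Exports.

Local Open Scope classical_set_scope.
Local Open Scope ring_scope.
Local Open Scope complex_scope.

(* The complex numbers over R as a normed module over themselves, so that
   [differentiable] below is complex (Frechet) differentiability. *)
Notation Cplx R := ((complex R)^o).
Notation Cplx2 R := ((Cplx R * Cplx R)%type).

Definition disc (R : realType) : set (Cplx R) := [set z | `|z| < 1].
Definition cdisc (R : realType) : set (Cplx R) := [set z | `|z| <= 1].
Definition circle (R : realType) : set (Cplx R) := [set z | `|z| = 1].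
Arguments disc : clear implicits.
Arguments cdisc : clear implicits.
Arguments circle : clear implicits.

Definition bidisc (R : realType) : set (Cplx2 R) := disc R `*` disc R.
Definition cbidisc (R : realType) : set (Cplx2 R) := cdisc R `*` cdisc R.
Arguments bidisc : clear implicits.
Arguments cbidisc : clear implicits.

(* Only used with A open. *)
Definition analytic_on (R : realType) (A : set (Cplx2 R))
    (f : Cplx2 R -> Cplx2 R) : Prop :=
  forall p, A p -> differentiable f p.

(* Maps with domain the closed bidisc, or its image under phi, are total
   functions whose values elsewhere are never used. *)
Definition bidisc_inv (R : realType) (phi : Cplx2 R -> Cplx2 R) :
  Cplx2 R -> Cplx2 R := pinv (cbidisc R) phi.

Definition embedded_bidisc (R : realType) (phi : Cplx2 R -> Cplx2 R) : Prop :=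
  [/\ {in cbidisc R &, injective phi},
      {within cbidisc R, continuous phi},
      {within phi @` cbidisc R, continuous (bidisc_inv phi)}
    & analytic_on (bidisc R) phi].

Definition Bopen (R : realType) (phi : Cplx2 R -> Cplx2 R) := phi @` bidisc R.
Definition Bclosed (R : realType) (phi : Cplx2 R -> Cplx2 R) :=
  phi @` cbidisc R.
Definition bdH (R : realType) (phi : Cplx2 R -> Cplx2 R) :=
  phi @` (cdisc R `*` circle R).
Definition bdV (R : realType) (phi : Cplx2 R -> Cplx2 R) :=
  phi @` (circle R `*` cdisc R).
Definition Hslice (R : realType) (phi : Cplx2 R -> Cplx2 R) (y : Cplx R) :=
  phi @` (disc R `*` [set y]).
Definition Vslice (R : realType) (phi : Cplx2 R -> Cplx2 R) (x : Cplx R) :=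
  phi @` ([set x] `*` disc R).

Definition proj1 (R : realType) (phi : Cplx2 R -> Cplx2 R) (p : Cplx2 R) :
  Cplx R := (bidisc_inv phi p).1.
Definition proj2 (R : realType) (phi : Cplx2 R -> Cplx2 R) (p : Cplx2 R) :
  Cplx R := (bidisc_inv phi p).2.

Definition proper_map (X Y : topologicalType) (E : set X) (V : set Y)
    (p : X -> Y) : Prop :=
  [/\ set_fun E V p,
      {within E, continuous p}
    & forall K : set Y, K `<=` V -> compact K -> compact (E `&` p @^-1` K)].

(* g - g z vanishes to order exactly k at z, i.e. g has local degree k at z. *)
Definition multiplicity (R : realType) (g : Cplx R -> Cplx R) (z : Cplx R)
    (k : nat) : Prop :=
  exists h : Cplx R -> Cplx R,
    [/\ \forall w \near z, differentiable h w,
        h z != 0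
      & \forall w \near z, g w - g z = (w - z) ^+ k * h w].

(* Each value in V is taken by g exactly d times in U, with multiplicity. *)
Definition has_degree (R : realType) (g : Cplx R -> Cplx R)
    (U V : set (Cplx R)) (d : nat) : Prop :=
  forall w, V w ->
    exists m : Cplx R -> nat,
      [/\ finite_set (U `&` g @^-1` [set w]),
          forall z, U z -> g z = w -> multiplicity g z (m z)
        & \big[addn/0%N]_(z \in U `&` g @^-1` [set w]) m z = d].

(* The curve F(H_y) /\ B carries the complex structure given by the injective
   parametrization x |-> F (phi (x, y)); multiplicities are computed in the
   coordinate x. *)
Definition horizontal_degree (R : realType) (phi F : Cplx2 R -> Cplx2 R)
    (d : nat) : Prop :=
  forall y, disc R y ->
    proper_map (F @` Hslice phi y `&` Bopen phi) (disc R) (proj1 phi) /\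
    has_degree (fun x => proj1 phi (F (phi (x, y))))
      [set x | disc R x /\ Bopen phi (F (phi (x, y)))] (disc R) d.

Definition vertical_degree (R : realType) (phi F : Cplx2 R -> Cplx2 R)
    (d : nat) : Prop :=
  forall x, disc R x ->
    proper_map (F @` Vslice phi x `&` Bopen phi) (disc R) (proj2 phi) /\
    has_degree (fun y => proj2 phi (F (phi (x, y))))
      [set y | disc R y /\ Bopen phi (F (phi (x, y)))] (disc R) d.

Definition horizontal (R : realType) (phi F : Cplx2 R -> Cplx2 R) : Prop :=
  (F @` Bclosed phi) `&` bdH phi = set0 /\
  Bclosed phi `&` (F @` bdV phi) = set0.

Definition vertical (R : realType) (phi F : Cplx2 R -> Cplx2 R) : Prop :=
  Bclosed phi `&` (F @` bdH phi) = set0 /\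
  (F @` Bclosed phi) `&` bdV phi = set0.

(* F is quasi-Henon-like of degree d, with G in the role of its inverse. *)
Definition quasi_henon_like (R : realType) (phi F G : Cplx2 R -> Cplx2 R)
    (d : nat) : Prop :=
  [/\ (2 <= d)%N /\ embedded_bidisc phi,
      [/\ {in Bclosed phi &, injective F},
          {within Bclosed phi, continuous F}
        & analytic_on (Bopen phi) F],
      [/\ {in Bclosed phi &, injective G},
          {within Bclosed phi, continuous G}
        & analytic_on (Bopen phi) G],
      (forall p, Bclosed phi p -> Bclosed phi (G p) -> F (G p) = p) /\
      (forall p, Bclosed phi p -> Bclosed phi (F p) -> G (F p) = p)
    & [/\ horizontal phi F \/ vertical phi F,
          horizontal phi F -> horizontal_degree phi F d
        & vertical phi F -> vertical_degree phi F d]].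

(* Iterates of f as a partial map with domain the closed bidisc. *)
Definition iter_image (R : realType) (phi f : Cplx2 R -> Cplx2 R) (m : nat) :
  set (Cplx2 R) :=
  iter m f @`
    [set p | Bopen phi p /\ forall j, (j < m)%N -> Bclosed phi (iter j f p)].

Definition iter_inter (R : realType) (phi f : Cplx2 R -> Cplx2 R) (n : nat) :
  set (Cplx2 R) :=
  \bigcap_(m in [set m | (m <= n)%N]) iter_image phi f m.

(* p : E -> V is isomorphic, over V, to the projection V * S -> V. *)
Definition trivial_fibration (X Y Z : topologicalType) (E : set X) (V : set Y)
    (p : X -> Y) (S : set Z) : Prop :=
  exists (h : X -> Y * Z) (g : Y * Z -> X),
    [/\ set_fun E (V `*` S) h /\ set_fun (V `*` S) E g,
        {in E, cancel h g} /\ {in V `*` S, cancel g h},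
        {within E, continuous h} /\ {within V `*` S, continuous g}
      & forall e, E e -> (h e).1 = p e].

(* The disjoint union of k discs; nat carries the discrete topology. *)
Definition discs (R : realType) (k : nat) : set (Cplx R * nat) :=
  disc R `*` `I_k.
Arguments discs : clear implicits.

Definition complex_horseshoe (R : realType) (phi F : Cplx2 R -> Cplx2 R)
    (d : nat) : Prop :=
  exists G : Cplx2 R -> Cplx2 R,
    quasi_henon_like phi F G d /\
    forall n : nat, (0 < n)%N ->
      (horizontal phi F ->
         trivial_fibration (iter_inter phi F n) (disc R) (proj1 phi)
           (discs R (d ^ n)) /\
         trivial_fibration (iter_inter phi G n) (disc R) (proj2 phi)
           (discs R (d ^ n))) /\
      (vertical phi F ->
         trivial_fibration (iter_inter phi F n) (disc R) (proj2 phi)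
           (discs R (d ^ n)) /\
         trivial_fibration (iter_inter phi G n) (disc R) (proj1 phi)
           (discs R (d ^ n))).

(* The embedding of the bidisc with image D_r x D_r. *)
Definition scaled_bidisc (R : realType) (r : R) (p : Cplx2 R) : Cplx2 R :=
  (r%:C * p.1, r%:C * p.2).

Definition henon_map (R : realType) (a c : Cplx R) (p : Cplx2 R) : Cplx2 R :=
  (p.1 ^+ 2 + c - a * p.2, p.1).

(* Main.v *)
Require Import Defs.
From HB Require Import structures.
From mathcomp Require Import all_boot all_order all_algebra.
From mathcomp Require Import complex.
From mathcomp Require Import all_classical all_reals all_analysis.
From mathcomp Require Import ring lra.
Import Order.TTheory GRing.Theory Num.Theory.
Import numFieldNormedType.Exports.
Import ComplexField.Normc.
Set Implicit Arguments.
Unset Strict Implicit.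
Unset Printing Implicit Defensive.
Local Open Scope classical_set_scope.
Local Open Scope ring_scope.
Local Open Scope complex_scope.

(* The points staying in the closed bidisc of radius r under n iterations in one
   direction are the pairs of consecutive terms of finite sequences with
   z_{j+1}^2 = al z_j + be z_{j+2} - c, 0 <= j < n.  For r slightly smaller than
   |c| / A - A / 4, A = 1 + |a|, the right-hand side stays in a disc avoiding 0,
   and (x, y) |-> sqrt (al x + be y - c) is a sup-norm contraction for either
   branch of the square root.  Hence the end values z_0, z_{n+1} and the n
   choices of branch determine the sequence: uniqueness and continuity follow
   from a maximum principle for the difference of two sequences, existence from
   the fixed points of contractions, by induction on n.  The end value z_0 is the
   base coordinate of the fibration, z_{n+1} the coordinate of the fibre discs,
   and the choices of branch index the 2^n discs. *)

(** * Real-valued modulus and separation of square roots *)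

Section ComplexModulus.
Variable R : realType.
Implicit Types (z w u v : Cplx R) (r : R).

Lemma normr_normc z : `|z| = (normc z)%:C.
Proof. by case: z. Qed.

Lemma normr_ltC z r : (`|z| < r%:C) = (normc z < r).
Proof. by rewrite normr_normc ltcR. Qed.

Lemma normr_leC z r : (`|z| <= r%:C) = (normc z <= r).
Proof. by rewrite normr_normc lecR. Qed.

Lemma normc_ge0 z : 0 <= normc z.
Proof. by case: z => x y; exact: sqrtr_ge0. Qed.

Lemma normcX z n : normc (z ^+ n) = normc z ^+ n.
Proof. by elim: n => [|n IH]; rewrite ?expr0 ?normc1 // !exprS normcM IH. Qed.

Lemma normc_real r : normc r%:C = `|r|.
Proof. by rewrite /= expr0n addr0 sqrtr_sqr. Qed.

Lemma le_normcB z w : normc (z - w) <= normc z + normc w.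
Proof. by rewrite -(normcN w); exact: le_normcD. Qed.

Lemma le_normc_dist z w : `|normc z - normc w| <= normc (z - w).
Proof.
rewrite ler_norml; apply/andP; split.
  rewrite lerNl opprB lerBlDr -(normcN (z - w)) opprB.
  by rewrite -{1}(subrK z w); exact: le_normcD.
by rewrite lerBlDr -{1}(subrK w z); exact: le_normcD.
Qed.

Lemma normcB_lt r z w :
  normc w + r < normc z -> r < normc (z - w).
Proof. by move=> h; have := le_normc_dist z w; rewrite ler_norml; lra. Qed.

Lemma sqr_normcE z : normc z ^+ 2 = complex.Re z ^+ 2 + complex.Im z ^+ 2.
Proof. by case: z => x y /=; rewrite sqr_sqrtr// addr_ge0 ?sqr_ge0. Qed.

Lemma Re_le_normc z : `|complex.Re z| <= normc z.
Proof.
rewrite -(@ler_pXn2r _ 2) ?nnegrE ?normc_ge0//.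
by rewrite sqr_normcE real_normK ?num_real// lerDl sqr_ge0.
Qed.

Lemma normc_eq0P z : normc z <= 0 -> z = 0.
Proof. by move=> h; apply: eq0_normc; have := normc_ge0 z; lra. Qed.

Lemma normc_gt0 z : z != 0 -> 0 < normc z.
Proof.
move=> z0; rewrite lt_neqAle normc_ge0 andbT eq_sym.
by apply: contra z0 => /eqP/eq0_normc ->.
Qed.

(* The component in the right half-plane of the Cassini oval |z^2 - 1| <= t
   lies to the right of sqrt (1 - t). *)
Lemma sqr_Re_ge z (t : R) : normc (z ^+ 2 - 1) <= t -> 1 - t <= complex.Re z ^+ 2.
Proof.
move=> h; set x := complex.Re z.
(* |z^2 - 1| is the product of the distances from z to 1 and to -1, and dropping the imaginary part
   of z only decreases both. *)
have h1 : (1 - x ^+ 2) ^+ 2 <= normc (z ^+ 2 - 1) ^+ 2.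
  rewrite (_ : z ^+ 2 - 1 = (z - 1) * (z + 1)); last by ring.
  rewrite normcM exprMn !sqr_normcE /x; case: z {h x} => x y /=.
  nra.
have h2 : (1 - x ^+ 2) ^+ 2 <= t ^+ 2.
  apply: le_trans h1 _; rewrite ler_pXn2r ?nnegrE ?normc_ge0//.
  exact: le_trans (normc_ge0 _) h.
have t0 : 0 <= t by exact: le_trans (normc_ge0 _) h.
have : `|1 - x ^+ 2| <= t by rewrite -(@ler_pXn2r _ 2) ?nnegrE// real_normK ?num_real.
by rewrite ler_norml; lra.
Qed.

(** In z^2 - w^2 = (z - w)(z + w) the real parts of z and w do not cancel in the second factor: |z +
    w| >= |Re z + Re w| >= 2m. *)
Lemma normcB_sqr_le z w (m : R) : 0 <= m ->
  m ^+ 2 <= complex.Re z ^+ 2 -> m ^+ 2 <= complex.Re w ^+ 2 ->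
  (0 < complex.Re z) = (0 < complex.Re w) ->
  2 * m * normc (z - w) <= normc (z ^+ 2 - w ^+ 2).
Proof.
move=> m0 hz hw hs; rewrite subr_sqr normcM mulrC ler_wpM2l ?normc_ge0//.
apply: le_trans (Re_le_normc (z + w)).
have -> : complex.Re (z + w) = complex.Re z + complex.Re w by case: z w {hz hw hs} => ? ? [].
move: (complex.Re z) (complex.Re w) hz hw hs => x y hx hy hs.
have ax : m <= `|x| by rewrite -(@ler_pXn2r _ 2) ?nnegrE// real_normK ?num_real.
have ay : m <= `|y| by rewrite -(@ler_pXn2r _ 2) ?nnegrE// real_normK ?num_real.
case: (ltP 0 x) hs ax => [x0 /esym y0|x0 /esym/negbT]; last rewrite -leNgt => y0.
  by move: ay; rewrite !gtr0_norm ?addr_gt0//; lra.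
move: ay; rewrite !ler0_norm //; lra.
Qed.

End ComplexModulus.

(** * Limits, compactness and fixed points in the complex plane *)

Section ComplexTopology.
Variable R : realType.
Implicit Types (z w u v : Cplx R) (r : R).

Lemma cvg_normcP (T : Type) (F : set_system T) (FF : Filter F)
    (f : T -> Cplx R) (l : Cplx R) :
  f @ F --> l <-> forall e : R, 0 < e -> \forall t \near F, normc (f t - l) < e.
Proof.
split=> [/cvgrPdist_lt h e e0|h].
  have /h : 0 < e%:C :> R[i] by rewrite ltcR.
  by apply: filterS => t; rewrite normr_ltC -normcN opprB.
apply/cvgrPdist_lt => e e0.
have eE : e = (complex.Re e)%:C by rewrite RRe_real// gtr0_real.
move: e0; rewrite eE ltcR => /h.
by apply: filterS => t; rewrite normr_ltC -normcN opprB.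
Qed.

Lemma near_normc z (e : R) : 0 < e -> \forall w \near z, normc (w - z) < e.
Proof. by move=> e0; have /cvg_normcP := @cvg_id _ (nbhs z); exact. Qed.

Lemma lipschitz_within_continuous (A : set (Cplx R)) (f : Cplx R -> R) (k : R) :
  (forall z w, A z -> A w -> `|f z - f w| <= k * normc (z - w)) ->
  {within A, continuous f}.
Proof.
move=> hf; apply/subspace_continuousP => z Az; apply/cvgrPdist_lt => e e0.
have d0 : 0 < e / (`|k| + 1) by rewrite divr_gt0// ltr_wpDl.
rewrite near_withinE; apply: filterS (near_normc z d0) => w hw Aw.
apply: le_lt_trans (hf _ _ Az Aw) _; rewrite -normcN opprB.
move: hw; rewrite ltr_pdivlMr ?ltr_wpDl// => hw; apply: le_lt_trans hw.
rewrite mulrC ler_wpM2l ?normc_ge0//.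
by apply: le_trans (ler_norm k) _; rewrite lerDl.
Qed.

Lemma Re_continuous : continuous (@complex.Re R : Cplx R -> R).
Proof.
move=> z; apply/(@cvgrPdist_lt _ _ _ (nbhs z)) => e e0; apply: filterS (near_normc z e0) => w.
apply: le_lt_trans; rewrite -normcN opprB.
have -> : complex.Re z - complex.Re w = complex.Re (z - w) by case: z w => ? ? [].
exact: Re_le_normc.
Qed.

Lemma normc_continuous : continuous (@normc R : Cplx R -> R).
Proof.
move=> z; apply/(@cvgrPdist_lt _ _ _ (nbhs z)) => e e0; apply: filterS (near_normc z e0) => w.
by apply: le_lt_trans; rewrite distrC; exact: le_normc_dist.
Qed.

(** The disc is a closed subset of the image of the real square [-r, r]^2 under the continuous map
    (x, y) |-> x + iy. *)
Lemma compact_closed_disc r : compact [set z : Cplx R | normc z <= r].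
Proof.
pose f (p : R * R) : Cplx R := p.1 +i* p.2.
have fc : continuous f.
  have fD p q : normc (f q - f p) <= `|p.1 - q.1| + `|p.2 - q.2|.
    have -> : f q - f p = (q.1 - p.1)%:C + 'i * (q.2 - p.2)%:C :> R[i].
      by rewrite /f; simpc.
    apply: le_trans (le_normcD _ _) _; rewrite normcM !normc_real.
    have -> : normc ('i : R[i]) = 1 by rewrite /= expr0n expr1n add0r sqrtr1.
    by rewrite mul1r distrC (distrC q.2).
  move=> p; apply/cvg_normcP => e e0.
  have e2 : 0 < e / 2 by lra.
  have h1 : \forall q \near p, `|p.1 - q.1| < e / 2.
    exact: ((@cvgrPdist_lt _ _ _ (nbhs p) _ fst p.1).1 cvg_fst).
  have h2 : \forall q \near p, `|p.2 - q.2| < e / 2.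
    exact: ((@cvgrPdist_lt _ _ _ (nbhs p) _ snd p.2).1 cvg_snd).
  near=> q; apply: le_lt_trans (fD p q) _.
  have : `|p.1 - q.1| < e / 2 by near: q.
  have : `|p.2 - q.2| < e / 2 by near: q.
  lra.
have cl : closed [set z : Cplx R | normc z <= r].
  rewrite (_ : mkset _ = (@normc R : Cplx R -> R) @^-1` [set x | x <= r])//.
  apply: closed_comp; last exact: closed_le.
  by move=> z _; exact: normc_continuous.
have cK : compact (f @` (`[- r, r] `*` `[- r, r])).
  apply: continuous_compact.
    exact: continuous_subspaceT.
  by apply: compact_setX; exact: segment_compact.
apply: subclosed_compact cl cK _ => -[x y] /= h.
have h1 := le_trans (Re_le_normc (x +i* y)) h.
have h2 : `|y| <= r.
  apply: le_trans h; rewrite -(@ler_pXn2r _ 2) ?nnegrE ?sqrtr_ge0//.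
  by rewrite sqr_sqrtr ?addr_ge0 ?sqr_ge0// real_normK ?num_real// lerDr sqr_ge0.
by exists (x, y) => //; split; rewrite /= in_itv /= -ler_norml.
Unshelve. all: by end_near. Qed.

(** By compactness |f z - z| has a minimum; passing from z to f z multiplies this quantity by at
    most k < 1, so the minimum is 0. *)
Lemma contraction_disc_fixpoint r (k : R) (f : Cplx R -> Cplx R) :
  0 <= r -> k < 1 ->
  (forall z, normc z <= r -> normc (f z) <= r) ->
  (forall z w, normc z <= r -> normc w <= r ->
     normc (f z - f w) <= k * normc (z - w)) ->
  exists2 z, normc z <= r & f z = z.
Proof.
move=> r0 k1 fr fk; pose D := [set z : Cplx R | normc z <= r].
have D0 : D !=set0 by exists 0; rewrite /D /mkset (_ : normc 0 = 0)//; exact: normc0.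
have gc : {within D, continuous (fun z => normc (f z - z) : R)}.
  apply: (@lipschitz_within_continuous _ _ (k + 1)) => z w Dz Dw.
  apply: le_trans (le_normc_dist _ _) _.
  rewrite (_ : f z - z - (f w - w) = (f z - f w) - (z - w)); last by ring.
  apply: le_trans (le_normcB _ _) _.
  by rewrite mulrDl mul1r lerD2r; exact: fk.
have [z /set_mem Dz zmin] := compact_EVT_min D0 (@compact_closed_disc r) gc.
exists z => //; apply/eqP; rewrite -subr_eq0; apply/eqP/normc_eq0P.
have := zmin _ (mem_set (fr _ Dz)); have := fk _ _ (fr _ Dz) Dz.
have := normc_ge0 (f z - z); nra.
Qed.

End ComplexTopology.

(* One step of the recurrence z_{j+1}^2 = al z_j + be z_{j+2} - c on consecutive
   pairs; (al, be) = (1, a) gives the inverse of henon_map a c, and (a, 1) gives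
   henon_map a c with the coordinates exchanged. *)
Definition three_term_step (R : realType) (al be c : Cplx R) (p : Cplx2 R) :
  Cplx2 R := (p.2, (p.2 ^+ 2 + c - al * p.1) / be).

(** The second coordinate of an iterate is the first coordinate of the next one, so first
    coordinates alone record the sequence, and [p] is its pair of terms 0 and 1. *)
Definition orbit_coord (R : realType) (al be c : Cplx R) (p : Cplx2 R)
  (j : nat) : Cplx R := (iter j (three_term_step al be c) p).1.

(* When sg^2 = - c and w is small compared to c, this tells the two square
   roots of w - c apart. *)
Definition positive_side (R : realType) (sg z : Cplx R) : bool :=
  0 < complex.Re (z / sg).

(** * Finite orbits with prescribed end values and choices of root *)

Section ThreeTermRecurrence.
Variables (R : realType) (al be c sg : Cplx R) (A r : R).
Hypotheses (be0 : be != 0) (leA : normc al + normc be <= A) (r0 : 0 < r)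
  (sg2 : sg ^+ 2 = - c)
  (escape : A * r + normc c < r ^+ 2)
  (contract : A ^+ 2 + 4 * (A * r) < 4 * normc c).
Implicit Types (z w : Cplx R) (p q : Cplx2 R) (e : nat -> bool).

Local Notation step := (three_term_step al be c).
Local Notation orb := (orbit_coord al be c).
Local Notation side := (positive_side sg).

Let A0 : 0 < A.
Proof. by move: (normc_gt0 be0) (normc_ge0 al) leA; lra. Qed.

Let Ar0 : 0 < A * r.
Proof. exact: mulr_gt0. Qed.

Let c0 : 0 < normc c.
Proof. by move: contract (sqr_ge0 A) Ar0; lra. Qed.

Let normc_sg2 : normc sg ^+ 2 = normc c.
Proof. by rewrite -normcX sg2; exact: normcN. Qed.

Let normc_sg_gt0 : 0 < normc sg.
Proof.
rewrite lt_neqAle normc_ge0 andbT; apply: contraTneq c0 => h.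
by rewrite -normc_sg2 -h expr0n ltxx.
Qed.

Let sg0 : sg != 0.
Proof. by apply: contraTneq normc_sg_gt0 => ->; rewrite (normc0 R) ltxx. Qed.

(** The lower bound for |Re (z / sg)| that [sqr_Re_ge] gives for a root z of w - c with |w| <= A
    r. *)
Let m := Num.sqrt (1 - A * r / normc c).

Let m2 : m ^+ 2 = 1 - A * r / normc c.
Proof.
rewrite sqr_sqrtr// subr_ge0 ler_pdivrMr// mul1r.
by move: contract (sqr_ge0 A) Ar0; lra.
Qed.

Let m_gt0 : 0 < m.
Proof.
rewrite sqrtr_gt0 subr_gt0 ltr_pdivrMr// mul1r.
by move: contract (sqr_ge0 A) Ar0; lra.
Qed.

(** Lipschitz constant of (x, y) |-> sqrt (al x + be y - c) on one side: [A] bounds the linear part,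
    and 2 m |sg| bounds the sum of two roots from below. *)
Let k := A / (2 * m * normc sg).

(** Squared, this reads A^2 < 4 (1 - A r / |c|) |c| = 4 |c| - 4 A r, which is [contract]. *)
Let k_lt1 : k < 1.
Proof.
have h : 0 < 2 * m * normc sg by rewrite !mulr_gt0.
rewrite ltr_pdivrMr// mul1r -(@ltr_pXn2r _ 2) ?nnegrE ?(ltW A0) ?(ltW h)//.
rewrite !exprMn m2 normc_sg2 mulrBr mulr1 mulrBl.
have -> : 2 ^+ 2 * (A * r / normc c) * normc c = 4 * (A * r).
  by field; rewrite gt_eqF.
by move: contract; lra.
Qed.

Let Re_root z w : z ^+ 2 = w - c -> normc w <= A * r ->
  m ^+ 2 <= complex.Re (z / sg) ^+ 2.
Proof.
move=> zE hw; rewrite m2; apply: sqr_Re_ge.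
have -> : (z / sg) ^+ 2 - 1 = w / - c.
  rewrite expr_div_n zE sg2; field.
  by apply: contraTneq c0 => ->; rewrite (normc0 R) ltxx.
rewrite normcM normcV (normcN c) ler_pM2r ?invr_gt0//.
Qed.

Lemma root_contraction z z' w w' (d : R) :
  z ^+ 2 = w - c -> z' ^+ 2 = w' - c -> normc w <= A * r -> normc w' <= A * r ->
  side z = side z' -> normc (w - w') <= A * d -> normc (z - z') <= k * d.
Proof.
move=> zE zE' hw hw' hs hd.
have := normcB_sqr_le (ltW m_gt0) (Re_root zE hw) (Re_root zE' hw') hs.
have -> : z / sg - z' / sg = (z - z') / sg by ring.
have -> : (z / sg) ^+ 2 - (z' / sg) ^+ 2 = (w - w') / sg ^+ 2.
  by rewrite !expr_div_n zE zE'; field.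
rewrite !normcM !normcV normcX => h.
have h2 : 2 * m * normc sg * normc (z - z') <= normc (w - w').
  move: h; rewrite expr2 invfM !mulrA -mulrA.
  set x := normc (w - w'); set y := normc (z - z'); move: normc_sg_gt0.
  set s := normc sg => s0 h.
  have := ler_pM2r (mulr_gt0 s0 s0) (2 * m * (y * s^-1)) (x / s / s).
  have -> : x / s / s * (s * s) = x by field; rewrite gt_eqF.
  have -> : 2 * m * (y * s^-1) * (s * s) = 2 * m * s * y.
    by field; rewrite gt_eqF.
  by move=> ->; rewrite !mulrA in h *.
rewrite /k mulrAC ler_pdivlMr; last by rewrite !mulr_gt0.
by rewrite mulrC; apply: le_trans h2 hd.
Qed.

Lemma root_Re_neq0 z w : z ^+ 2 = w - c -> normc w <= A * r ->
  complex.Re (z / sg) != 0.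
Proof.
move=> zE hw; have := Re_root zE hw; apply: contraTneq => ->.
by rewrite -ltNge expr0n exprn_gt0.
Qed.

(** The two roots are opposite and, divided by [sg], have nonzero real part, so each side contains
    one of them. *)
Lemma root_exists w (b : bool) : normc w <= A * r ->
  exists2 z, z ^+ 2 = w - c & side z = b.
Proof.
move=> hw; pose z := sqrtc (w - c).
have zE : z ^+ 2 = w - c by exact: sqr_sqrtc.
have nz := root_Re_neq0 zE hw.
have [hb|hb] := boolP (side z == b); first by exists z => //; apply/eqP.
exists (- z); first by rewrite sqrrN.
move: hb; rewrite /positive_side mulNr.
have -> : complex.Re (- (z / sg)) = - complex.Re (z / sg) by case: (z / sg).
by case: b; rewrite oppr_gt0; case: (ltrgtP (complex.Re (z / sg)) 0) nz.
Qed.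

Lemma comb_normc_le x y (d : R) : normc x <= d -> normc y <= d ->
  normc (al * x + be * y) <= A * d.
Proof.
move=> hx hy; apply: le_trans (le_normcD _ _) _; rewrite !normcM.
have d0 : 0 <= d by exact: le_trans (normc_ge0 x) hx.
apply: (@le_trans _ _ ((normc al + normc be) * d)); last exact: ler_wpM2r.
by rewrite mulrDl lerD// ler_wpM2l// normc_ge0.
Qed.

(** Here [escape] enters: |z|^2 <= A r + |c| < r^2. *)
Lemma root_normc_lt z w : z ^+ 2 = w - c -> normc w <= A * r -> normc z < r.
Proof.
move=> zE hw; rewrite -(@ltr_pXn2r _ 2) ?nnegrE ?normc_ge0 ?(ltW r0)//.
rewrite -normcX zE; apply: le_lt_trans (le_normcB _ _) _.
by apply: le_lt_trans escape; rewrite lerD2r.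
Qed.

Lemma orbit_recurrence p j : orb p j.+1 ^+ 2 = al * orb p j + be * orb p j.+2 - c.
Proof.
rewrite {3}/orbit_coord iterS iterS /three_term_step /= /orbit_coord /=; field.
exact: be0.
Qed.

Lemma orbit_coord_step p j : orb (step p) j = orb p j.+1.
Proof. by rewrite /orbit_coord -iterSr. Qed.

(* At an interior index where the difference of two orbits is largest, the
   contraction property forces it to vanish. *)
Lemma orbit_dist_le p q n (d : R) :
  (forall j, (j <= n.+1)%N -> normc (orb p j) <= r) ->
  (forall j, (j <= n.+1)%N -> normc (orb q j) <= r) ->
  (forall j, (0 < j <= n)%N -> side (orb p j) = side (orb q j)) ->
  normc (orb p 0 - orb q 0) <= d -> normc (orb p n.+1 - orb q n.+1) <= d ->
  forall j, (j <= n.+1)%N -> normc (orb p j - orb q j) <= d.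
Proof.
move=> hp hq hs h0 hn.
pose D (i : 'I_n.+2) := normc (orb p i - orb q i).
have [i _ imax] := @Order.TotalTheory.arg_maxP _ _ _ ord0 xpredT D isT.
suff Di : D i <= d.
  by move=> j jn; apply: le_trans Di; exact: (imax (Ordinal (jn : (j < n.+2)%N))).
have dist j : (j <= n.+1)%N -> normc (orb p j - orb q j) <= D i.
  by move=> jn; exact: (imax (Ordinal (jn : (j < n.+2)%N))).
have [i0|] := posnP i; first by rewrite /D i0.
have := ltn_ord i; rewrite ltnS leq_eqVlt => /orP[/eqP iE _|]; first by rewrite /D iE.
case iE : (nat_of_ord i) => [//|j] jn _.
have j1 : (j <= n.+1)%N by exact: ltnW (ltnW jn).
have hDi : D i <= k * D i.
  rewrite {1}/D iE; apply: (@root_contraction _ _ _ _ _ (orbit_recurrence p j) (orbit_recurrence q j)).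
  - by apply: comb_normc_le; apply: hp.
  - by apply: comb_normc_le; apply: hq.
  - by apply: hs; rewrite ltnS in jn.
  - rewrite (_ : al * orb p j + _ - _ =
      al * (orb p j - orb q j) + be * (orb p j.+2 - orb q j.+2)); last by ring.
    by apply: comb_normc_le; apply: dist.
have := normc_ge0 (orb p 0 - orb q 0).
have : 0 <= D i by exact: normc_ge0.
move: k_lt1; nra.
Qed.

(** Induction on [n]: a guess u for term 1 yields, by induction, an orbit from u to w. The
    prescribed root of the recurrence at term 1 then gives a new guess; this is a contraction in u,
    and its fixed point makes the sequence consistent. *)
Lemma orbit_with_itinerary n e z w : normc z <= r -> normc w <= r ->
  exists p, [/\ orb p 0 = z, orb p n.+1 = w,
    forall j, (j <= n.+1)%N -> normc (orb p j) <= r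
    & forall j, (0 < j <= n)%N -> side (orb p j) = e j].
Proof.
elim: n e z => [|n IH] e z hz hw.
  exists (z, w); split => // [[|[]]//|[|[]]//].
(* [psi u] starts the orbit from u to w with the itinerary shifted by one; outside the disc its
   value is arbitrary. *)
have /choice [psi psiP] : forall u, exists p, normc u <= r ->
    [/\ orb p 0 = u, orb p n.+1 = w,
     forall j, (j <= n.+1)%N -> normc (orb p j) <= r
     & forall j, (0 < j <= n)%N -> side (orb p j) = e j.+1].
  move=> u; have [hu|hu] := boolP (normc u <= r).
    by have [p hp] := IH (fun j => e j.+1) u hu hw; exists p.
  by exists (0, 0).
pose W u := al * z + be * orb (psi u) 1.
have WP u : normc u <= r -> normc (W u) <= A * r.
  by move=> /psiP[_ _ hr _]; apply: comb_normc_le => //; apply: hr.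
have /choice [T TP] : forall u, exists v, normc u <= r ->
    v ^+ 2 = W u - c /\ side v = e 1%N.
  move=> u; have [hu|hu] := boolP (normc u <= r).
    by have [v vE vs] := root_exists (e 1%N) (WP u hu); exists v.
  by exists 0.
have [u hu Tu] : exists2 u, normc u <= r & T u = u.
  apply: (contraction_disc_fixpoint (ltW r0) k_lt1) => [u hu|u v hu hv].
    by have [vE _] := TP u hu; apply/ltW/(root_normc_lt vE)/WP.
  have [uE us] := TP u hu; have [vE vs] := TP v hv.
  apply: (root_contraction uE vE) => //; first exact: WP.
  - exact: WP.
  - by rewrite us vs.
  (* The left neighbour [z] is fixed and contributes 0. The right neighbours are compared by
     [orbit_dist_le], as the ends of the two orbits differ by u - v and by 0. *)
  - rewrite (_ : W u - W v = al * 0 + be * (orb (psi u) 1 - orb (psi v) 1));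
      last by rewrite /W; ring.
    apply: comb_normc_le; first by rewrite (normc0 R) normc_ge0.
    have [u0 un ur us'] := psiP u hu; have [v0 vn vr vs'] := psiP v hv.
    apply: (@orbit_dist_le _ _ n) => //.
    + by move=> j jn; rewrite us' ?vs'.
    + by rewrite u0 v0.
    + by rewrite un vn subrr (normc0 R) normc_ge0.
have [uE us] := TP u hu; rewrite Tu in uE us.
have [p0 pn pr ps] := psiP u hu.
(* The fixed-point equation is the recurrence at term 1, so the orbit of (z, u) is z followed by the
   orbit of [psi u]. *)
have stepE : step (z, u) = psi u.
  rewrite /three_term_step /= uE /W.
  have -> : (al * z + be * orb (psi u) 1 - c + c - al * z) / be = orb (psi u) 1.
    by field; exact: be0.
  by rewrite -{1}p0 /orbit_coord /=; case: (psi u).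
have orbE j : orb (z, u) j.+1 = orb (psi u) j by rewrite -orbit_coord_step stepE.
exists (z, u); split; rewrite ?orbE//.
  by move=> [//|j] jn; rewrite orbE; exact: pr.
move=> [//|[|j]] jn; rewrite orbE; first by rewrite p0.
by apply: ps; rewrite ltnS in jn.
Qed.

(** Interior terms are roots, hence strictly inside by [root_normc_lt]; only the two ends need a
    hypothesis. *)
Lemma orbit_lt p n :
  (forall j, (j <= n.+1)%N -> normc (orb p j) <= r) ->
  normc (orb p 0) < r -> normc (orb p n.+1) < r ->
  forall j, (j <= n.+1)%N -> normc (orb p j) < r.
Proof.
move=> hp h0 hn [//|j]; rewrite leq_eqVlt => /orP[/eqP[->]//|jn].
apply: (root_normc_lt (orbit_recurrence p j)); apply: comb_normc_le; apply: hp => //.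
by exact: ltnW (ltnW jn).
Qed.

End ThreeTermRecurrence.

(** * Differentiability and continuity of the step and its orbits *)

Lemma cvg_to_pair (T : Type) (U V : topologicalType) (F : set_system T)
    (FF : Filter F) (f : T -> U) (g : T -> V) (u : U) (v : V) :
  f @ F --> u -> g @ F --> v -> (fun x => (f x, g x)) @ F --> (u, v).
Proof. by move=> fu gv; apply: cvg_pair; [exact: fu|exact: gv]. Qed.

Section Differentiability.
Variable R : realType.
Implicit Types p : Cplx2 R.

Lemma differentiable_fst p : differentiable (fst : Cplx2 R -> Cplx R) p.
Proof.
by apply: (@linear_differentiable _ _ _ (fst : Cplx2 R -> Cplx R)) => x;
  apply: cvg_fst.
Qed.

Lemma differentiable_snd p : differentiable (snd : Cplx2 R -> Cplx R) p.
Proof.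
by apply: (@linear_differentiable _ _ _ (snd : Cplx2 R -> Cplx R)) => x;
  apply: cvg_snd.
Qed.

Lemma divr_continuous (u : Cplx R) : continuous (fun z : Cplx R => z / u).
Proof.
rewrite (_ : (fun z => _) = *:%R u^-1); first exact: scaler_continuous.
by apply/funext => z; rewrite /GRing.scale /= mulrC.
Qed.

Lemma three_term_step_differentiable (al be c : Cplx R) p :
  differentiable (three_term_step al be c) p.
Proof.
apply: differentiable_pair; first exact: differentiable_snd.
have -> : (fun y : Cplx2 R => (y.2 ^+ 2 + c - al * y.1) / be) =
    be^-1 *: (snd * snd + cst c - al *: fst) :> (Cplx2 R -> Cplx R).
  by apply/funext => y; rewrite !fctE /GRing.scale /= mulrC.
apply/differentiableZ/differentiableB.
  apply: differentiableD; last exact: differentiable_cst.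
  by apply: differentiableM; exact: differentiable_snd.
exact/differentiableZ/differentiable_fst.
Qed.

Lemma three_term_step_continuous (al be c : Cplx R) :
  continuous (three_term_step al be c).
Proof.
by move=> p; exact/differentiable_continuous/three_term_step_differentiable.
Qed.

Lemma orbit_coord_continuous (al be c : Cplx R) j :
  continuous (fun p => orbit_coord al be c p j).
Proof.
have stepj : continuous (iter j (three_term_step al be c)).
  elim: j => [|j IH] p; first exact: cvg_id.
  apply: continuous_comp; first exact: IH.
  exact: three_term_step_continuous.
move=> p; apply: continuous_comp; first exact: stepj.
exact/differentiable_continuous/differentiable_fst.
Qed.

End Differentiability.

(** * The trivial fibration of the set of finite orbits *)

Section ItineraryFibration.
Variables (R : realType) (al be c sg : Cplx R) (A r : R).
Hypotheses (be0 : be != 0) (leA : normc al + normc be <= A) (r0 : 0 < r)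
  (sg2 : sg ^+ 2 = - c)
  (escape : A * r + normc c < r ^+ 2)
  (contract : A ^+ 2 + 4 * (A * r) < 4 * normc c).
Variable n : nat.
Implicit Types (z w : Cplx R) (p q : Cplx2 R).

Local Notation step := (three_term_step al be c).
Local Notation orb := (orbit_coord al be c).
Local Notation side := (positive_side sg).

Let E := [set p | forall j, (j <= n.+1)%N -> normc (orb p j) < r].

(** Only the interior terms 1 to n carry a choice of root, hence the shift; a finite function type
    lets [enum_rank] number the 2^n itineraries. *)
Let itinerary p : {ffun 'I_n -> bool} := [ffun i : 'I_n => side (orb p i.+1)].

Let h p : Cplx R * (Cplx R * nat) :=
  (p.1 / r%:C, (orb p n.+1 / r%:C, nat_of_ord (enum_rank (itinerary p)))).

(** The inverse of [h], by choice; (0, 0) is the default off the image of [E]. *)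
Let g y : Cplx2 R := xget (0, 0) [set p | E p /\ h p = y].


Let S := discs R (2 ^ n).

Let rC0 : r%:C != 0 :> R[i].
Proof. by rewrite (inj_eq (@complexI R)) gt_eqF. Qed.

Let normc_divr z : normc (z / r%:C) = normc z / r.
Proof. by rewrite normcM normcV normc_real gtr0_norm. Qed.

Let itineraryP p q (i : 'I_n) : itinerary p = itinerary q ->
  side (orb p i.+1) = side (orb q i.+1).
Proof. by move/ffunP => /(_ i); rewrite !ffunE. Qed.

(** Equal labels mean equal itineraries, so [orbit_dist_le] controls term 1 by the two ends. With d
    = 0 this gives injectivity of [h], with small d continuity of [g]. *)
Let dist p q (d : R) : E p -> E q -> (h p).2.2 = (h q).2.2 ->
  normc (p.1 - q.1) <= d -> normc (orb p n.+1 - orb q n.+1) <= d ->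
  normc (p.1 - q.1) <= d /\ normc (p.2 - q.2) <= d.
Proof.
move=> Ep Eq /= /ord_inj/enum_rank_inj pq d0 dn; split => //.
apply: (orbit_dist_le be0 leA r0 sg2 contract (p := p) (q := q) (n := n) _ _ _ d0 dn (j := 1)) => //.
- by move=> j jn; exact/ltW/Ep.
- by move=> j jn; exact/ltW/Eq.
- by move=> [//|j] jn; exact: (itineraryP (Ordinal jn)).
Qed.

Let disc_divr z : normc z < r -> disc R (z / r%:C).
Proof.
by move=> zr; rewrite /disc /= (normr_ltC _ 1) normc_divr ltr_pdivrMr ?mul1r.
Qed.

Let hES p : E p -> (disc R `*` S) (h p).
Proof.
move=> Ep; split; first exact/disc_divr/(Ep 0).
split; first exact: disc_divr (Ep _ (leqnn _)).
by apply: (leq_trans (ltn_ord _)); rewrite card_ffun card_bool card_ord.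
Qed.

Let h_inj p q : E p -> E q -> h p = h q -> p = q.
Proof.
move=> Ep Eq pq.
have rV0 : (r%:C)^-1 != 0 :> R[i] by rewrite invr_eq0.
have h1 : p.1 = q.1 by apply: (mulIf rV0); exact: (congr1 fst pq).
have hn : orb p n.+1 = orb q n.+1.
  by apply: (mulIf rV0); exact: (congr1 (fun y => y.2.1) pq).
have [||_ /normc_eq0P/eqP] := dist (d := 0) Ep Eq (congr1 (fun y => y.2.2) pq).
- by rewrite h1 subrr (normc0 R).
- by rewrite hn subrr (normc0 R).
rewrite subr_eq0 => /eqP.
by case: p q h1 {Ep Eq pq hn} => ? ? [? ?] /= -> ->.
Qed.

Let h_surj y : (disc R `*` S) y -> exists p, E p /\ h p = y.
Proof.
case: y => x [w k] [/= Dx [/= Dw kn]].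
have hk : (k < #|{ffun 'I_n -> bool}|)%N by rewrite card_ffun card_bool card_ord.
pose e := enum_val (Ordinal hk).
have lt_r z : disc R z -> normc (r%:C * z) < r.
  rewrite /disc /= (normr_ltC _ 1) normcM normc_real gtr0_norm// => z1.
  by rewrite -{2}(mulr1 r) ltr_pM2l.
(* Term j takes entry j - 1 of [e]; no interior term meets the default [true]. *)
have [p [p0 pn pr ps]] := orbit_with_itinerary be0 leA r0 sg2 escape contract n
  (fun j => if insub j.-1 is Some i then e i else true)
  (ltW (lt_r _ Dx)) (ltW (lt_r _ Dw)).
exists p; split.
  by apply: (orbit_lt be0 leA r0 escape pr); rewrite ?p0 ?pn; exact: lt_r.
have itE : itinerary p = e.
  by apply/ffunP => i; rewrite ffunE ps ?ltn_ord// valK.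
have eE : nat_of_ord (enum_rank e) = k by rewrite /e enum_valK.
rewrite /h itE eE pn [p.1]p0.
by congr (_, (_, _)); rewrite mulrC mulKf.
Qed.

Let gP y : (disc R `*` S) y -> E (g y) /\ h (g y) = y.
Proof.
move=> /h_surj[p hp].
exact: (xgetPex (0, 0) (ex_intro [set q | E q /\ h q = y] p hp)).
Qed.

(** The real part that defines the side is continuous in the point and never 0 on [E], so its sign
    is locally constant. *)
Let side_near p (i : 'I_n) : E p ->
  \forall q \near p, E q -> side (orb q i.+1) = side (orb p i.+1).
Proof.
move=> Ep; pose f q := complex.Re (orb q i.+1 / sg).
have fc : continuous f.
  move=> q; apply: (@continuous_comp _ _ _ (fun q => orb q i.+1)
    (fun z : Cplx R => complex.Re (z / sg))).
    exact: orbit_coord_continuous.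
  apply: (@continuous_comp _ _ _ (fun z : Cplx R => z / sg)
    (@complex.Re R : Cplx R -> R)); last exact: Re_continuous.
  exact: divr_continuous.
have ne q : E q -> f q != 0.
  move=> Eq; have ij := ltn_ord i; rewrite /f.
  apply: (root_Re_neq0 be0 leA r0 sg2 contract (orbit_recurrence _ _ be0 q i)).
  by apply: (comb_normc_le leA); apply/ltW/Eq; [exact: leqW (ltnW ij)|exact: ij].
have e0 : 0 < `|f p| by rewrite normr_gt0 ne.
near=> q => Eq.
have hq : `|f p - f q| < `|f p|.
  by near: q; exact: (@cvgrPdist_lt _ _ _ (nbhs p) _ f (f p)).1 (fc p) _ e0.
rewrite /positive_side -/(f q) -/(f p).
case: (ltrgtP 0 (f p)) (ne _ Ep) hq => // fp0 _.
  by rewrite (gtr0_norm fp0) ltr_norml; case: (ltP 0 (f q)) => //; lra.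
by rewrite (ltr0_norm fp0) ltr_norml; case: (ltP 0 (f q)) => //; lra.
Unshelve. all: by end_near. Qed.

Let h_continuous : {within E, continuous h}.
Proof.
apply/subspace_continuousP => p Ep.
apply: cvg_to_pair.
  apply: cvg_within_filter; apply: (continuous_comp (g := fun z : Cplx R => z / r%:C)).
    exact/differentiable_continuous/differentiable_fst.
  exact: divr_continuous.
apply: cvg_to_pair.
  apply: cvg_within_filter; apply: (@continuous_comp _ _ _ (fun q => orb q n.+1)
    (fun z : Cplx R => z / r%:C)).
    exact: orbit_coord_continuous.
  exact: divr_continuous.
(* In the discrete factor, convergence means that the label is constant near [p] in [E]; this
   follows from [side_near] for the finitely many interior terms. *)
apply/discrete_cvg.
suff near_it : \forall q \near p, E q -> itinerary q = itinerary p.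
  rewrite /nbhs /= /within /=.
  by apply: filterS near_it => q qp Eq; rewrite qp.
have near_side : \forall q \near p, forall i : 'I_n,
    E q -> side (orb q i.+1) = side (orb p i.+1).
  exact: (@filter_forall _ _ (fun (i : 'I_n) (q : Cplx2 R) =>
    E q -> side (orb q i.+1) = side (orb p i.+1)) (nbhs p) _
    (fun i => side_near i Ep)).
near=> q => Eq; apply/ffunP => i; rewrite !ffunE; move: i Eq.
by near: q.
Unshelve. all: by end_near. Qed.

Let g_continuous : {within disc R `*` S, continuous g}.
Proof.
apply/subspace_continuousP => y Vy.
have [Egy hgy] := gP Vy.
suff key : forall e : R, 0 < e -> \forall y' \near within (disc R `*` S) (nbhs y),
    normc ((g y').1 - (g y).1) < e /\ normc ((g y').2 - (g y).2) < e.
  have gE : g = fun y => ((g y).1, (g y).2) by apply/funext => u; case: (g u).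
  rewrite [X in _ --> X](congr1 (@^~ y) gE) [X in X @ _ --> _]gE.
  apply: cvg_to_pair; apply/cvg_normcP => e e0.
    near=> y'; suff [] : normc ((g y').1 - (g y).1) < e /\
      normc ((g y').2 - (g y).2) < e by [].
    by near: y'; exact: key.
  near=> y'; suff [] : normc ((g y').1 - (g y).1) < e /\
    normc ((g y').2 - (g y).2) < e by [].
  by near: y'; exact: key.
move=> e e0; rewrite near_withinE.
(* Undoing the division by r turns this bound into e / 2, leaving room for the non-strict inequality
   of [dist]. *)
have d0 : 0 < e / (2 * r) by rewrite divr_gt0 ?mulr_gt0.
have n1 : \forall y' \near y, normc (y'.1 - y.1) < e / (2 * r).
  exact: (@cvg_normcP _ _ (nbhs y) _ fst y.1).1 cvg_fst _ d0.
have n2 : \forall y' \near y, normc (y'.2.1 - y.2.1) < e / (2 * r).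
  apply: (@cvg_normcP _ _ (nbhs y) _ (fun y => y.2.1) y.2.1).1 d0.
  by apply: (cvg_comp _ _ cvg_snd); exact: cvg_fst.
have n3 : \forall y' \near y, y'.2.2 = y.2.2.
  have : (fun y' : Cplx R * (Cplx R * nat) => y'.2.2) @ nbhs y --> y.2.2.
    by apply: (cvg_comp _ _ cvg_snd); exact: cvg_snd.
  by move/discrete_cvg.
near=> y' => Vy'; have [Egy' hgy'] := gP Vy'.
have sc z z' : normc (z' / r%:C - z / r%:C) < e / (2 * r) ->
    normc (z' - z) <= e / 2.
  rewrite -mulrBl normc_divr ltr_pdivrMr// => /ltW.
  by rewrite (_ : e / (2 * r) * r = e / 2)//; field; rewrite gt_eqF.
have h3 : (h (g y')).2.2 = (h (g y)).2.2 by rewrite hgy hgy'; near: y'.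
have h1 : normc ((g y').1 - (g y).1) <= e / 2.
  apply: sc; rewrite -[_ / _]/(h (g y')).1 -[X in _ - X]/(h (g y)).1 hgy hgy'.
  by near: y'.
have h2 : normc (orb (g y') n.+1 - orb (g y) n.+1) <= e / 2.
  apply: sc; rewrite -[_ / _]/(h (g y')).2.1 -[X in _ - X]/(h (g y)).2.1 hgy hgy'.
  by near: y'.
have [d1 d2] := dist Egy' Egy h3 h1 h2.
by split; [apply: le_lt_trans d1 _|apply: le_lt_trans d2 _]; lra.
Unshelve. all: by end_near. Qed.

Theorem itinerary_fibration :
  trivial_fibration E (disc R) (fun p : Cplx2 R => p.1 / r%:C) S.
Proof.
exists h, g; split; [split|split|split|].
- exact: hES.
- by move=> y /gP[].
- move=> p /set_mem Ep; have [Eg hg] := gP (hES Ep); exact: h_inj.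
- by move=> y /set_mem /gP[].
- exact: h_continuous.
- exact: g_continuous.
- by [].
Qed.

End ItineraryFibration.

(** * Intersections of iterated images and transport of fibrations *)

Lemma iter_can (T : Type) (f g : T -> T) m : cancel f g -> cancel (iter m f) (iter m g).
Proof. by move=> fK x; elim: m => //= m IH; rewrite -iterS iterSr /= fK. Qed.

(** The points passed on the way from the m-th backward iterate of q up to q are backward iterates
    of lower order, so the domain condition on partial iterates already follows from the right-hand
    side. *)
Lemma iter_inter_can (R : realType) (phi f g : Cplx2 R -> Cplx2 R) n :
  cancel f g -> cancel g f -> Bopen phi `<=` Bclosed phi ->
  iter_inter phi f n =
  [set q | forall m, (m <= n)%N -> Bopen phi (iter m g q)].
Proof.
move=> fK gK BB; apply/seteqP; split=> [q hq m mn|q hq m mn].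
  by have [p [Bp _] <-] := hq m mn; rewrite iter_can.
exists (iter m g q); last exact: iter_can.
split=> [|j jm]; first exact: hq.
have -> : iter j f (iter m g q) = iter (m - j) g q.
  by rewrite -{1}(subnKC (ltnW jm)) iterD iter_can.
by apply/BB/hq; rewrite (leq_trans (leq_subr _ _)).
Qed.

Lemma trivial_fibration_eq (X Y Z : topologicalType) (E : set X) (V : set Y)
    (p p' : X -> Y) (S : set Z) :
  (forall e, E e -> p e = p' e) ->
  trivial_fibration E V p S -> trivial_fibration E V p' S.
Proof.
by move=> pp [h [g [a1 a2 a3 a4]]]; exists h, g; split=> // e Ee; rewrite a4// pp.
Qed.

Lemma trivial_fibration_comp (X X' Y Z : topologicalType) (E : set X)
    (i : X' -> X) (i' : X -> X') (V : set Y) (p : X -> Y) (S : set Z) :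
  cancel i i' -> cancel i' i -> continuous i -> continuous i' ->
  trivial_fibration E V p S ->
  trivial_fibration (i @^-1` E) V (p \o i) S.
Proof.
move=> iK i'K ic i'c [h [g [[hE gV] [hK gK] [hc gc] hp]]].
exists (h \o i), (i' \o g); split.
- by split=> [x /hE//|y /gV Ey] /=; rewrite /preimage /= i'K.
- split=> [x /set_mem Ex /=|y Vy /=]; first by rewrite hK ?iK// inE.
  by rewrite i'K gK.
- split; apply/subspace_continuousP => x Ex.
    have /subspace_continuousP/(_ _ Ex) hx := hc.
    by move=> U /hx hU; exact: (ic x _ hU).
  have /subspace_continuousP/(_ _ Ex) hg := gc.
  by apply: cvg_comp hg _; exact: i'c.
- by move=> x Ex /=; rewrite hp.
Qed.

(** * The bidisc of radius r and its boundary pieces *)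

Section ScaledBidisc.
Variables (R : realType) (r : R).
Hypothesis r0 : 0 < r.
Implicit Types (p : Cplx2 R) (z : Cplx R).

Local Notation phi := (scaled_bidisc r).

Lemma scale_neq0 : r%:C != 0 :> R[i].
Proof. by rewrite (inj_eq (@complexI R)) gt_eqF. Qed.

Lemma normc_scale z : normc (r%:C * z) = r * normc z.
Proof. by rewrite normcM normc_real gtr0_norm. Qed.

Lemma scaled_bidiscK : cancel phi (fun p => (p.1 / r%:C, p.2 / r%:C)).
Proof.
by move=> [x y]; rewrite /scaled_bidisc /= ![r%:C * _]mulrC !mulfK ?scale_neq0.
Qed.

Lemma scaled_bidiscVK : cancel (fun p => (p.1 / r%:C, p.2 / r%:C)) phi.
Proof.
by move=> [x y]; rewrite /scaled_bidisc /= ![r%:C * _]mulrC !divfK ?scale_neq0.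
Qed.

Lemma cdiscP z : cdisc R z <-> normc (r%:C * z) <= r.
Proof.
by rewrite normc_scale /cdisc /= (normr_leC z 1) -{2}(mulr1 r) ler_pM2l.
Qed.

Lemma discP z : disc R z <-> normc (r%:C * z) < r.
Proof.
by rewrite normc_scale /disc /= (normr_ltC z 1) -{2}(mulr1 r) ltr_pM2l.
Qed.

Lemma circleP z : circle R z <-> normc (r%:C * z) = r.
Proof.
rewrite normc_scale /circle /= normr_normc; split=> [[->]|h]; first by rewrite mulr1.
by congr _%:C; apply: (mulfI (lt0r_neq0 r0)); rewrite h mulr1.
Qed.

Lemma image_scaled_bidisc (A B A' B' : set (Cplx R)) :
  (forall z, A z <-> A' (r%:C * z)) -> (forall z, B z <-> B' (r%:C * z)) ->
  phi @` (A `*` B) = A' `*` B'.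
Proof.
move=> AA BB; apply/seteqP; split=> [_ [[x y] [/= Ax By] <-]|[x y] [/= Ax By]].
  by split; [exact/AA|exact/BB].
exists (x / r%:C, y / r%:C); last exact: (scaled_bidiscVK (x, y)).
by split; [apply/AA|apply/BB]; rewrite /= mulrC divfK ?scale_neq0.
Qed.

Lemma BclosedE :
  Bclosed phi = [set z | normc z <= r] `*` [set z | normc z <= r].
Proof. by apply: image_scaled_bidisc => z; exact: cdiscP. Qed.

Lemma BopenE : Bopen phi = [set z | normc z < r] `*` [set z | normc z < r].
Proof. by apply: image_scaled_bidisc => z; exact: discP. Qed.

Lemma bdHE : bdH phi = [set z | normc z <= r] `*` [set z | normc z = r].
Proof. by apply: image_scaled_bidisc => z; [exact: cdiscP|exact: circleP]. Qed.

Lemma bdVE : bdV phi = [set z | normc z = r] `*` [set z | normc z <= r].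
Proof. by apply: image_scaled_bidisc => z; [exact: circleP|exact: cdiscP]. Qed.

Lemma Bopen_sub_closed : Bopen phi `<=` Bclosed phi.
Proof. by rewrite BopenE BclosedE => p [/ltW ? /ltW ?]. Qed.

Lemma bidisc_invE p : Bclosed phi p -> bidisc_inv phi p = (p.1 / r%:C, p.2 / r%:C).
Proof.
move=> [q Dq <-]; rewrite scaled_bidiscK /bidisc_inv pinvKV ?inE//.
by move=> x y _ _; exact: (can_inj scaled_bidiscK).
Qed.

Lemma scaled_bidisc_differentiable p : differentiable phi p.
Proof.
by apply: differentiable_pair; apply: (differentiableZ (r%:C : R[i]));
  [exact: differentiable_fst|exact: differentiable_snd].
Qed.

Lemma scaled_bidisc_embedded : embedded_bidisc phi.
Proof.
split.
- by move=> x y _ _; exact: (can_inj scaled_bidiscK).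
- apply: continuous_subspaceT => p.
  exact/differentiable_continuous/scaled_bidisc_differentiable.
- apply: (subspace_eq_continuous (f := fun p => (p.1 / r%:C, p.2 / r%:C))).
    by move=> p /set_mem Bp; exact: esym (bidisc_invE Bp).
  apply: continuous_subspaceT => p; apply: cvg_to_pair.
    apply: (@continuous_comp _ _ _ fst (fun z : Cplx R => z / r%:C)).
      exact/differentiable_continuous/differentiable_fst.
    exact: divr_continuous.
  apply: (@continuous_comp _ _ _ snd (fun z : Cplx R => z / r%:C)).
    exact/differentiable_continuous/differentiable_snd.
  exact: divr_continuous.
- by move=> p _; exact: scaled_bidisc_differentiable.
Qed.

End ScaledBidisc.

(** * The Henon map on the bidisc *)

Definition swap_pair (X Y : Type) (p : X * Y) : Y * X := (p.2, p.1).

Lemma swap_pairK (X Y : Type) : cancel (@swap_pair X Y) (@swap_pair Y X).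
Proof. by case. Qed.

Lemma swap_pair_continuous (X Y : topologicalType) : continuous (@swap_pair X Y).
Proof. by move=> p; apply: cvg_to_pair; [exact: cvg_snd|exact: cvg_fst]. Qed.

Section HenonMap.
Variables (R : realType) (a c : Cplx R) (r : R).
Hypotheses (a0 : a != 0) (r0 : 0 < r).
Let A : R := 1 + normc a.
Hypotheses (escape : A * r + normc c < r ^+ 2)
  (contract : A ^+ 2 + 4 * (A * r) < 4 * normc c).
Implicit Types (p q : Cplx2 R) (x y z w : Cplx R).

Local Notation phi := (scaled_bidisc r).
Local Notation F := (henon_map a c).
Local Notation G := (three_term_step 1 a c).

Lemma henonK : cancel F G.
Proof.
by move=> [x y]; rewrite /three_term_step /henon_map /=; congr (_, _); field.
Qed.

Lemma henonVK : cancel G F.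
Proof.
by move=> [x y]; rewrite /three_term_step /henon_map /=; congr (_, _); field.
Qed.

Lemma henon_swap p : F (swap_pair p) = swap_pair (three_term_step a 1 c p).
Proof. by case: p => x y; rewrite /swap_pair /three_term_step /henon_map /= divr1. Qed.

Lemma henon_differentiable p : differentiable F p.
Proof.
apply: differentiable_pair; last exact: differentiable_fst.
apply: differentiableB; last exact/(differentiableZ (a : R[i]))/differentiable_snd.
apply: differentiableD; last exact: differentiable_cst.
by apply: differentiableM; exact: differentiable_fst.
Qed.

Lemma henon_continuous : continuous F.
Proof. by move=> p; exact/differentiable_continuous/henon_differentiable. Qed.

Let A1 : 1 <= A.
Proof. by rewrite lerDl normc_ge0. Qed.

Let leA : normc (1 : Cplx R) + normc a <= A.
Proof. by rewrite (normc1 R). Qed.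

Let leA' : normc a + normc (1 : Cplx R) <= A.
Proof. by rewrite (normc1 R) addrC. Qed.

Let c_large : A * r < normc c.
Proof. by move: contract (sqr_ge0 A) A1; lra. Qed.

(** |x^2 + c - a y| >= r^2 - |c| - |a| r > r by [escape]. Both halves of horizontality rest on this,
    since the second coordinate of F (x, y) is x. *)
Lemma henon_escape x y : normc x = r -> normc y <= r -> r < normc (F (x, y)).1.
Proof.
move=> xr yr; rewrite /=.
rewrite (_ : x ^+ 2 + c - a * y = x ^+ 2 - (a * y - c)); last by ring.
apply: normcB_lt; rewrite normcX xr; apply: le_lt_trans escape.
have := le_normcB (a * y) c; rewrite normcM /A mulrDl mul1r.
by have := ler_wpM2l (normc_ge0 a) yr; lra.
Qed.

Lemma henon_horizontal : horizontal phi F.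
Proof.
split; rewrite ?bdHE ?bdVE ?BclosedE//; apply/eqP/negPn/negP => /set0P[q].
  move=> [[[x y] [/= xr yr] <-] [/= qr xr']].
  by have := henon_escape xr' yr; move: qr => /=; lra.
by move=> [[qr _] [[x y] [/= xr yr] qE]]; have := henon_escape xr yr;
  move: qr; rewrite -qE /=; lra.
Qed.

(* F (B) meets the vertical boundary at the image of (x, 0), x^2 = r - c. *)
Lemma henon_not_vertical : ~ vertical phi F.
Proof.
move=> [_]; apply/eqP/set0P; pose x : Cplx R := sqrtc (r%:C - c).
have xE : x ^+ 2 = r%:C - c by exact: sqr_sqrtc.
have xr : normc x < r.
  apply: (root_normc_lt r0 escape xE).
  by rewrite normc_real gtr0_norm// -{1}(mul1r r) ler_pM2r.
have n0 : normc (0 : Cplx R) <= r by rewrite (normc0 R) ltW.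
rewrite (bdVE r0) (BclosedE r0); exists (F (x, 0)); split.
  by exists (x, 0) => //; split; [exact: ltW|exact: n0].
split; last exact: ltW.
by rewrite /mkset /= xE subrK mulr0 subr0 normc_real gtr0_norm.
Qed.

(** * Properness and degree on a horizontal slice *)

Section Slice.
Variable y : Cplx R.
Hypothesis Dy : disc R y.

Let yr : normc (r%:C * y) < r.
Proof. exact/(discP r0). Qed.

Let root_bound x w : (r%:C * x) ^+ 2 + c - a * (r%:C * y) = w -> normc w <= r ->
  normc (r%:C * x) < r.
Proof.
move=> xw wr; apply: (root_normc_lt r0 escape (w := 1 * w + a * (r%:C * y))).
  by rewrite -xw; ring.
by apply: (comb_normc_le leA) => //; exact: ltW.
Qed.

(** The preimage of K is cut out of a compact product by the closed equation [(G p).2 = r%:C * y].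
    The closed disc may serve as second factor because [root_bound] puts the solutions in the open
    one. *)
Lemma slice_proper :
  proper_map (F @` Hslice phi y `&` Bopen phi) (disc R) (proj1 phi).
Proof.
have p1E p : Bopen phi p -> proj1 phi p = p.1 / r%:C.
  by move=> /(Bopen_sub_closed r0) Bp; rewrite /proj1 bidisc_invE.
split.
- move=> p [_ Bp]; rewrite p1E//; move: Bp; rewrite BopenE// => -[/= pr _].
  by apply/(discP r0); rewrite mulrC divfK ?scale_neq0.
- apply: (subspace_eq_continuous (f := fun p => p.1 / r%:C)).
    by move=> p /set_mem[_ Bp]; exact: esym (p1E p Bp).
  apply: continuous_subspaceT => p.
  apply: (@continuous_comp _ _ _ fst (fun z : Cplx R => z / r%:C)).
    exact/differentiable_continuous/differentiable_fst.
  exact: divr_continuous.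
- move=> K KD cK.
  (* Multiplication by r, written as a division so that [divr_continuous] applies. *)
  pose rK := (fun z : Cplx R => z / (r%:C)^-1) @` K.
  have crK : compact rK.
    by apply: continuous_compact cK; apply: continuous_subspaceT; exact: divr_continuous.
  have -> : F @` Hslice phi y `&` Bopen phi `&` proj1 phi @^-1` K =
      rK `*` [set z | normc z <= r] `&` [set p | (G p).2 = r%:C * y].
    apply/seteqP; split=> p.
      move=> [[[q [[x y'] [/= Dx ->] qE] pE] Bp]].
      rewrite /preimage /mkset p1E// => Kp; split; last first.
        by rewrite -pE; apply: etrans (congr1 snd (henonK q)) _; rewrite -qE.
      split; first by exists (p.1 / r%:C) => //; rewrite invrK divfK ?scale_neq0.
      by rewrite -pE -qE; apply/ltW/(discP r0).
    move=> [[[k Kk kp] p2] Gp].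
    have p1 : normc p.1 < r.
      by rewrite -kp invrK mulrC; apply/(discP r0)/KD.
    have pE : F (phi (p.2 / r%:C, y)) = p.
      rewrite -[RHS]henonVK; congr F; rewrite /scaled_bidisc /= -Gp.
      by rewrite mulrC divfK ?scale_neq0.
    have p2r : normc p.2 < r.
      rewrite -(divfK (scale_neq0 r0) p.2) mulrC; apply: (root_bound (w := p.1)).
        by rewrite -[in RHS]pE.
      exact: ltW.
    have Bp : Bopen phi p by rewrite BopenE.
    split; last by rewrite /preimage /= p1E// -kp invrK mulfK ?scale_neq0.
    split=> //; exists (phi (p.2 / r%:C, y)) => //.
    exists (p.2 / r%:C, y) => //; split=> //=.
    by apply/(discP r0); rewrite mulrC divfK ?scale_neq0.
  apply: compact_closedI (compact_setX crK (@compact_closed_disc R r)) _.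
  apply: (@closed_comp _ _ (fun p => (G p).2) [set r%:C * y]).
    move=> p _; apply: continuous_comp; first exact: three_term_step_continuous.
    exact/differentiable_continuous/differentiable_snd.
  exact/accessible_closed_set1/hausdorff_accessible/norm_hausdorff.
Qed.

Let V : set (Cplx R) := [set x | disc R x /\ Bopen phi (F (phi (x, y)))].
Let g x := proj1 phi (F (phi (x, y))).

Let VP x : V x <->
  normc (r%:C * x) < r /\ normc ((r%:C * x) ^+ 2 + c - a * (r%:C * y)) < r.
Proof.
rewrite /V /= BopenE//; split=> [[/(discP r0) ? [] //]|[h1 h2]].
by split; [exact/(discP r0)|split].
Qed.

Let gE x : V x -> g x = ((r%:C * x) ^+ 2 + c - a * (r%:C * y)) / r%:C.
Proof. by move=> [_ /(Bopen_sub_closed r0) h]; rewrite /g /proj1 bidisc_invE. Qed.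

(** Both inequalities of [VP] are strict bounds on coordinates of [F (phi (x, y))], the second
    coordinate being r x, so they persist by continuity. *)
Let V_near x : V x -> \forall x' \near x, V x'.
Proof.
move=> /VP[h1 h2].
pose q (x : Cplx R) := F (phi (x, y)).
have qc : continuous q.
  move=> z; apply: (@continuous_comp _ _ _ (fun x => phi (x, y)) F);
    last exact: henon_continuous.
  apply: (@continuous_comp _ _ _ (fun x : Cplx R => (x, y)) phi).
    by apply: (@cvg_to_pair _ _ _ (nbhs z) _ id (cst y)); [exact: cvg_id|exact: cvg_cst].
  exact/differentiable_continuous/scaled_bidisc_differentiable.
have near_lt (pr : Cplx2 R -> Cplx R) : continuous pr -> normc (pr (q x)) < r ->
    \forall x' \near x, normc (pr (q x')) < r.
  move=> prc qr.
  apply: (@continuous_comp _ _ _ (pr \o q) (@normc R : Cplx R -> R) x _ _ _ (lt_nbhsl qr)).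
    by apply: continuous_comp; [exact: qc|exact: prc].
  exact: normc_continuous.
near=> x'; apply/VP; split; near: x'.
  apply: (near_lt snd) => // p.
  exact/differentiable_continuous/differentiable_snd.
apply: (near_lt fst) => // p.
exact/differentiable_continuous/differentiable_fst.
Unshelve. all: by end_near. Qed.

(** The equation g x = w becomes (r x)^2 = u - c with |u| <= A r < |c|, so it has two distinct
    simple solutions. *)
Lemma slice_degree : has_degree g V (disc R) 2.
Proof.
move=> w /(discP r0) wr; set u := 1 * (r%:C * w) + a * (r%:C * y).
have ur : normc u <= A * r by apply: (comb_normc_le leA); exact: ltW.
pose s : Cplx R := sqrtc (u - c).
have sE : s ^+ 2 = u - c by exact: sqr_sqrtc.
have sr : normc s < r by exact: root_normc_lt sE ur.
have s0 : s != 0.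
  apply: contraTneq c_large => s0; rewrite -leNgt; move: sE.
  by rewrite s0 expr0n /= => /esym/eqP; rewrite subr_eq0 => /eqP <-.
have two0 : 2%:R != 0 :> R[i] by rewrite pnatr_eq0.
have VgP x : (V `&` g @^-1` [set w]) x <-> r%:C * x = s \/ r%:C * x = - s.
  have -> : (r%:C * x = s \/ r%:C * x = - s) <-> (r%:C * x) ^+ 2 = s ^+ 2.
    split=> [[->|->]|/eqP]; rewrite ?sqrrN//.
    by rewrite eqf_sqr => /orP[] /eqP ->; [left|right].
  rewrite sE /u; split=> [[Vx]|xE].
    rewrite /preimage /= gE// => /(congr1 ( *%R^~ r%:C)).
    by rewrite divfK ?scale_neq0// (mulrC _ w) => <-; ring.
  have xE' : (r%:C * x) ^+ 2 + c - a * (r%:C * y) = r%:C * w by rewrite xE; ring.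
  have Vx : V x by apply/VP; rewrite xE'; split=> //; apply: root_bound xE' _; exact: ltW.
  by split=> //; rewrite /preimage /= gE// xE' mulrC mulKf ?scale_neq0.
have VgE : V `&` g @^-1` [set w] = [set s / r%:C] `|` [set - s / r%:C].
  apply/seteqP; split=> x.
    by move=> /VgP[] <-; [left|right]; rewrite /= mulrC mulKf ?scale_neq0.
  by move=> [] ->; apply/VgP; [left|right]; rewrite mulrC divfK ?scale_neq0.
exists (fun=> 1%N); split.
- by rewrite VgE finite_setU.
- move=> z Vz gz; have /VgP zs : (V `&` g @^-1` [set w]) z by [].
  have z0 : z != 0.
    apply: contra s0 => /eqP z0; move: zs; rewrite z0 mulr0.
    by case=> /eqP; rewrite eq_sym ?oppr_eq0.
  (* g x - g z = (x - z) r (x + z), and the cofactor is 2 r z at x = z. *)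
  exists (fun x => r%:C *: (x + z)); split.
  + near=> x; apply: differentiableZ; apply: differentiableD.
      by apply: ex_diff.
    exact: differentiable_cst.
  + by rewrite scaler_eq0 negb_or scale_neq0//= -mulr2n -mulr_natr mulf_neq0.
  + near=> x; rewrite !gE//; last by near: x; exact: V_near.
    by rewrite expr1 /GRing.scale /=; field; exact: scale_neq0.
- rewrite VgE fsbigU0 ?fsbig_set1//.
  move=> x [/= -> /(congr1 ( *%R^~ r%:C))]; rewrite !divfK ?scale_neq0// => /eqP.
  by rewrite -subr_eq0 opprK -mulr2n -mulr_natr mulf_eq0 (negPf s0) (negPf two0).
Unshelve. all: by end_near. Qed.

End Slice.

Lemma henon_quasi_henon_like : quasi_henon_like phi F G 2.
Proof.
split.
- by split=> //; exact: scaled_bidisc_embedded.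
- split; first by move=> p q _ _; exact: (can_inj henonK).
    exact/continuous_subspaceT/henon_continuous.
  by move=> p _; exact: henon_differentiable.
- split; first by move=> p q _ _; exact: (can_inj henonVK).
    exact/continuous_subspaceT/three_term_step_continuous.
  by move=> p _; exact: three_term_step_differentiable.
- by split=> p _ _; [exact: henonVK|exact: henonK].
- split; first by left; exact: henon_horizontal.
    by move=> _ y Dy; split; [exact: slice_proper|exact: slice_degree].
  by move/henon_not_vertical.
Qed.

(** The m-th iterate is the pair of terms m and m + 1, whence the bound n + 1 on the indices. *)
Lemma Bopen_orbit (al be : Cplx R) n p :
  (forall m, (m <= n)%N -> Bopen phi (iter m (three_term_step al be c) p)) <->
  (forall j, (j <= n.+1)%N -> normc (orbit_coord al be c p j) < r).
Proof.
rewrite BopenE//; split=> [hp j|hp m mn].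
  rewrite leq_eqVlt => /orP[/eqP ->|jn]; last by have [] := hp j jn.
  by have [] := hp n (leqnn n).
by split; [exact: hp (leqW mn)|exact: hp m.+1 mn].
Qed.

Lemma Bopen_swap p : Bopen phi (swap_pair p) <-> Bopen phi p.
Proof. by rewrite BopenE//; split=> -[]. Qed.

Lemma iter_henon_swap m p :
  swap_pair (iter m F p) = iter m (three_term_step a 1 c) (swap_pair p).
Proof.
elim: m => //= m <-; set q := iter m F p.
by rewrite -{1}(swap_pairK q) henon_swap swap_pairK.
Qed.

Lemma henon_horseshoe : complex_horseshoe phi F 2.
Proof.
have sgE : (sqrtc (- c) : Cplx R) ^+ 2 = - c by exact: sqr_sqrtc.
exists G; split; first exact: henon_quasi_henon_like.
move=> n _; split; last by move/henon_not_vertical.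
move=> _; split.
  (* Forward images under F are conditions on the iterates of G, whose term 0 is the first
     coordinate. *)
  have -> : iter_inter phi F n =
      [set p | forall j, (j <= n.+1)%N -> normc (orbit_coord 1 a c p j) < r].
    rewrite (iter_inter_can n henonK henonVK (Bopen_sub_closed r0)).
    by apply/seteqP; split=> p /Bopen_orbit.
  apply: trivial_fibration_eq (itinerary_fibration a0 leA r0 sgE escape contract n).
  move=> p /Bopen_orbit/(_ 0%N isT)/(Bopen_sub_closed r0) Bp.
  by rewrite /proj1 bidisc_invE.
(* Images under G are conditions on the iterates of F; after the exchange of coordinates term 0 is
   the second coordinate. *)
have -> : iter_inter phi G n = @swap_pair _ _ @^-1`
    [set p | forall j, (j <= n.+1)%N -> normc (orbit_coord a 1 c p j) < r].
  rewrite (iter_inter_can n henonVK henonK (Bopen_sub_closed r0)).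
  apply/seteqP; split=> p.
    move=> hp; apply/Bopen_orbit => m mn.
    by rewrite -iter_henon_swap; apply/Bopen_swap/hp.
  move=> /Bopen_orbit hp m mn.
  by apply/Bopen_swap; rewrite iter_henon_swap; exact: hp.
apply: trivial_fibration_eq (trivial_fibration_comp (@swap_pairK _ _)
  (@swap_pairK _ _) (@swap_pair_continuous _ _) (@swap_pair_continuous _ _)
  (itinerary_fibration (oner_neq0 _) leA' r0 sgE escape contract n)).
move=> p /Bopen_orbit/(_ 0%N isT)/Bopen_swap/(Bopen_sub_closed r0) Bp.
by rewrite /proj2 bidisc_invE.
Qed.

End HenonMap.

(* With t = C / A^2 the conclusions are solvable in r as soon as
   t^2 - 5t/2 + 5/16 > 0, whose larger root is 5/4 + sqrt 5 / 2. *)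
Lemma radius_exists (R : realType) (A C : R) : 0 < A ->
  (5 / 4 + Num.sqrt 5 / 2) * A ^+ 2 < C ->
  exists r, [/\ 0 < r, A * r + C < r ^+ 2 & A ^+ 2 + 4 * (A * r) < 4 * C].
Proof.
move=> A0 hC; set s : R := Num.sqrt 5 in hC *.
have s0 : 0 <= s by exact: sqrtr_ge0.
have s2 : s ^+ 2 = 5 by rewrite sqr_sqrtr.
have A2 : 0 < A ^+ 2 by rewrite exprn_gt0.
have C0 : 0 < C by nra.
(* The third conclusion is equivalent to r < R1. *)
pose R1 := C / A - A / 4.
have AR1 : A * R1 = C - A ^+ 2 / 4 by rewrite /R1; field; rewrite gt_eqF.
have R10 : 0 < R1.
  rewrite -(@pmulr_rgt0 _ A)// AR1; nra.
(* The margin in the second conclusion at r = R1. *)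
pose f := R1 ^+ 2 - A * R1 - C.
have f0 : 0 < f.
  rewrite -(@pmulr_rgt0 _ (A ^+ 2))//.
  have -> : A ^+ 2 * f = C ^+ 2 - 5 / 2 * C * A ^+ 2 + 5 / 16 * (A ^+ 2) ^+ 2.
    have -> : A ^+ 2 * f = (A * R1) ^+ 2 - A ^+ 2 * (A * R1) - A ^+ 2 * C.
      by rewrite /f; ring.
    by rewrite AR1; field.
  (* The last summand vanishes because s^2 = 5; it makes the factorization an identity in s. *)
  have -> : C ^+ 2 - 5 / 2 * C * A ^+ 2 + 5 / 16 * (A ^+ 2) ^+ 2 =
     (C - (5 / 4 + s / 2) * A ^+ 2) * (C - (5 / 4 - s / 2) * A ^+ 2)
     + (s ^+ 2 - 5) / 4 * (A ^+ 2) ^+ 2 by field.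
  rewrite s2 subrr !mul0r addr0 mulr_gt0 ?subr_gt0//; nra.
(* At r = R1 - d the margin is f - 2 R1 d + A d + d^2 = A d + d^2 > 0, and 2 R1 r = R1^2 + A R1 + C
   > 0. *)
pose d := f / (2 * R1).
have d0 : 0 < d by rewrite divr_gt0// mulr_gt0.
have dE : 2 * R1 * d = f by rewrite /d; field; rewrite gt_eqF.
exists (R1 - d); split.
- by move: dE; rewrite /f => dE; nra.
- by rewrite sqrrB -mulr_natr; move: dE; rewrite /f => dE; nra.
- by rewrite mulrBr AR1; nra.
Qed.

Theorem proposition2p10 (R : realType) (a c : Cplx R) (ha : a != 0)
    (hc : (5 / 4 + Num.sqrt 5 / 2 : R)%:C * (1 + `|a|) ^+ 2 < `|c|) :
  exists r : R, 0 < r /\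
    complex_horseshoe (scaled_bidisc r) (henon_map a c) 2.
Proof.
have A0 : 0 < 1 + normc a by rewrite ltr_pwDl// normc_ge0.
have [|r [r0 escape contract]] := radius_exists (C := normc c) A0.
  have aE : 1 + `|a| = (1 + normc a)%:C by rewrite rmorphD normr_normc.
  by move: hc; rewrite aE normr_normc -rmorphXn -rmorphM ltcR.
by exists r; split=> //; exact: henon_horseshoe.
Qed.
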